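(* Let $\iota: I'\xrightarrow{i'}I\xrightarrow{i''}I''$ be a short doubly exact sequence in $\mathrm{Bmod}^{\mathfrak s}$ whose middle term $I$ is both injective and projective in $\mathrm{Bmod}^{\mathfrak s}$. Then the functor $F:=\underline{\mathrm{Hom}}_{\mathrm{Bmod}^{\mathfrak s}}(I'',-)$ satisfies condition (a) with respect to an arbitrary morphism of short doubly exact sequences $c\to\iota$, provided this holds for all endomorphisms of $I'$ in $\mathrm{Bmod}^{\mathfrak s}$. That is: suppose that for every endomorphism $v$ of $I'$ and any two morphisms of short doubly exact sequences $w_1,w_2:\iota\to\iota$ both inducing $v$ on $I'$, one has $F(w_1'')=F(w_2''):\mathrm{Coker}(F(i''))\to\mathrm{Coker}(F(i''))$. Then for every short doubly exact sequence $c:C'\xrightarrow{c'}C\xrightarrow{c''}C''$, every morphism $v:C'\to I'$ and any two morphisms of short doubly exact sequences $w_1,w_2:c\to\iota$ both inducing $v:C'\to I'$, one has $F(w''_1)=F(w''_2):\mathrm{Coker}(F(c''))\to\mathrm{Coker}(F(i''))$.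
   Context: $\mathbb B=\{0,1\}$ is the Boolean semifield ($1+1=1$). A $\mathbb B$-module is a commutative monoid $(M,+,0)$ with $x+x=x$ for all $x$; morphisms are the monoid homomorphisms. $\mathrm{Bmod}^{\mathfrak s}$ is the category of $\mathbb B$-modules endowed with an involution $\sigma$ (an endomorphism with $\sigma^2=\mathrm{id}$), with morphisms the $\mathbb B$-module morphisms commuting with $\sigma$. $M^\sigma$ is the set of fixed points of $\sigma$. Injective and projective objects are taken in the usual categorical sense (with respect to monomorphisms and epimorphisms, which are the injective, respectively surjective, morphisms). For $h:L\to M$, $\mathrm{Ker}(h):=h^{-1}(M^\sigma)$ (with its inclusion in $L$), and $\mathrm{Coker}(h):=M/\!\sim$ (with the quotient map), where $b\sim b'$ iff $g(b)=g(b')$ for every object $X$ and every morphism $g:M\to X$ of $\mathrm{Bmod}^{\mathfrak s}$ with $\mathrm{Range}(h)\subset\mathrm{Ker}(g)$. A short doubly exact sequence is a pair of morphisms $L\xrightarrow{m}M\xrightarrow{q}N$ such that $m$ is the kernel of $q$ and $q$ is the cokernel of $m$ (up to canonical isomorphism). A morphism $w:c\to\iota$ of such sequences is a triple $(w':C'\to I',\ w:C\to I,\ w'':C''\to I'')$ commuting with the structure maps; it is said to induce $v$ if $w'=v$. $\underline{\mathrm{Hom}}_{\mathrm{Bmod}^{\mathfrak s}}(L,M)$ is the $\mathbb B$-module of morphisms $L\to M$ with pointwise addition and involution $f\mapsto\sigma\circ f=f\circ\sigma$; $F=\underline{\mathrm{Hom}}_{\mathrm{Bmod}^{\mathfrak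 s}}(I'',-)$ is a covariant endofunctor of $\mathrm{Bmod}^{\mathfrak s}$. For a morphism $w:c\to\iota$, the map $F(w''):F(C'')\to F(I'')$ descends to a map $\mathrm{Coker}(F(c''))\to\mathrm{Coker}(F(i''))$, still denoted $F(w'')$. *)

(* Defs.v *)
From HB Require Import structures.
From mathcomp Require Import all_boot ssralg.
From mathcomp Require Import generic_quotient.
From mathcomp Require Import boolp.

Set Implicit Arguments.
Unset Strict Implicit.
Unset Printing Implicit Defensive.

Import GRing.Theory.
Local Open Scope ring_scope.
Local Open Scope quotient_scope.

Reserved Notation "{ 'bmods' U -> V }"
  (at level 0, U at level 98, V at level 99, format "{ 'bmods'  U  ->  V }").

(* [nmodType] contains a [choiceType] structure; under the choice axiom of    *)
(* [boolp] every type has one, so this does not restrict the carriers, and a  *)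
(* B-module is just a commutative monoid with idempotent addition.            *)
HB.mixin Record Nmodule_isBmods V of GRing.Nmodule V := {
  addbb : forall x : V, x + x = x;
  sigma : V -> V;
  sigma0 : sigma 0 = 0;
  sigmaD : {morph sigma : x y / x + y};
  sigmaK : involutive sigma
}.

#[short(type="bmodsType")]
HB.structure Definition Bmods := {V of Nmodule_isBmods V & GRing.Nmodule V}.

HB.mixin Record isSigmaMorphism (U V : bmodsType) (f : U -> V) := {
  sigma_morph : {morph f : x / sigma x}
}.

HB.structure Definition BmodsHom (U V : bmodsType) :=
  {f of isSigmaMorphism U V f & GRing.isNmodMorphism U V f}.

Notation "{ 'bmods' U -> V }" := (BmodsHom.type U%type V%type) : type_scope.

Lemma bmods_hom_ext (U V : bmodsType) (f g : {bmods U -> V}) : f =1 g -> f = g.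
Proof.
case: f g => [f [[a] [b]]] [g [[c] [d]]] /= /funext fg.
by subst g; rewrite (Prop_irrelevance a c) (Prop_irrelevance b d).
Qed.

Section Category.
Variables L M N : bmodsType.

Lemma idfun_sigma : {morph (idfun : L -> L) : x / sigma x}.
Proof. by []. Qed.
HB.instance Definition _ := isSigmaMorphism.Build L L idfun idfun_sigma.

Variables (g : {bmods M -> N}) (f : {bmods L -> M}).
Lemma comp_sigma : {morph g \o f : x / sigma x}.
Proof. by move=> x /=; rewrite !sigma_morph. Qed.
HB.instance Definition _ := isSigmaMorphism.Build L N (g \o f) comp_sigma.
End Category.

Definition bid (L : bmodsType) : {bmods L -> L} := idfun.
Definition bcomp (L M N : bmodsType) (g : {bmods M -> N}) (f : {bmods L -> M}) :
  {bmods L -> N} := g \o f.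

Definition bmods_iso (L M : bmodsType) (f : {bmods L -> M}) : Prop :=
  exists g : {bmods M -> L}, bcomp g f = bid L /\ bcomp f g = bid M.

Definition bmods_mono (L M : bmodsType) (f : {bmods L -> M}) : Prop :=
  forall (X : bmodsType) (g h : {bmods X -> L}), bcomp f g = bcomp f h -> g = h.

Definition bmods_epi (L M : bmodsType) (f : {bmods L -> M}) : Prop :=
  forall (X : bmodsType) (g h : {bmods M -> X}), bcomp g f = bcomp h f -> g = h.

Definition injective_object (I : bmodsType) : Prop :=
  forall (L M : bmodsType) (f : {bmods L -> M}) (u : {bmods L -> I}),
    bmods_mono f -> exists u' : {bmods M -> I}, bcomp u' f = u.

Definition projective_object (P : bmodsType) : Prop :=
  forall (L M : bmodsType) (f : {bmods L -> M}) (u : {bmods P -> M}),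
    bmods_epi f -> exists u' : {bmods P -> L}, bcomp f u' = u.

Definition fixed (M : bmodsType) : {pred M} := [pred x | sigma x == x].
Arguments fixed : clear implicits.

Section Kernel.
Variables (L M : bmodsType) (h : {bmods L -> M}).

Definition ker_pred : pred L := [pred x | h x \in fixed M].

Lemma ker_nmod_closed : GRing.nmod_closed ker_pred.
Proof.
split=> [|x y]; rewrite !inE ?raddf0 ?sigma0 // => /eqP hx /eqP hy.
by rewrite raddfD sigmaD hx hy.
Qed.

Record Ker : Type := InKer { ker_val : L; ker_valP : ker_pred ker_val }.
HB.instance Definition _ := [isSub for ker_val].
HB.instance Definition _ := [Choice of Ker by <:].
HB.instance Definition _ :=
  GRing.SubChoice_isSubNmodule.Build L ker_pred Ker ker_nmod_closed.

Lemma ker_val_nmod : GRing.nmod_morphism ker_val.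
Proof. by split=> [|x y]; [exact: (raddf0 val) | exact: (raddfD val)]. Qed.

Lemma ker_sigma_subproof (x : Ker) : ker_pred (sigma (ker_val x)).
Proof.
by case: x => x /= /eqP hx; apply/eqP; rewrite sigma_morph hx.
Qed.
Definition ker_sigma (x : Ker) : Ker := InKer (ker_sigma_subproof x).

Lemma ker_addbb (x : Ker) : x + x = x.
Proof. by apply: val_inj; rewrite [LHS]ker_val_nmod.2 addbb. Qed.
Lemma ker_sigma0 : ker_sigma 0 = 0.
Proof. by apply: val_inj; rewrite /= [X in sigma X]ker_val_nmod.1 sigma0. Qed.
Lemma ker_sigmaD : {morph ker_sigma : x y / x + y}.
Proof.
move=> x y; apply: val_inj.
by rewrite [RHS]ker_val_nmod.2 /= [X in sigma X]ker_val_nmod.2 sigmaD.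
Qed.
Lemma ker_sigmaK : involutive ker_sigma.
Proof. by move=> x; apply: val_inj; rewrite /= sigmaK. Qed.
HB.instance Definition _ :=
  Nmodule_isBmods.Build Ker ker_addbb ker_sigma0 ker_sigmaD ker_sigmaK.

Lemma ker_val_sigma : {morph ker_val : x / sigma x}.
Proof. by []. Qed.
HB.instance Definition _ := GRing.isNmodMorphism.Build Ker L ker_val ker_val_nmod.
HB.instance Definition _ := isSigmaMorphism.Build Ker L ker_val ker_val_sigma.

Definition ker_incl : {bmods Ker -> L} := ker_val.

End Kernel.

Section Cokernel.
Variables (L M : bmodsType) (h : {bmods L -> M}).

Definition range_in_ker (X : bmodsType) (g : {bmods M -> X}) : Prop :=
  forall x : L, h x \in ker_pred g.

Definition coker_rel (b b' : M) : bool :=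
  `[< forall (X : bmodsType) (g : {bmods M -> X}), range_in_ker g -> g b = g b' >].

Lemma coker_rel_refl : reflexive coker_rel.
Proof. by move=> x; apply/asboolP. Qed.
Lemma coker_rel_sym : symmetric coker_rel.
Proof.
by move=> x y; apply/asboolP/asboolP => H X g /H ->.
Qed.
Lemma coker_rel_trans : transitive coker_rel.
Proof.
move=> y x z /asboolP xy /asboolP yz; apply/asboolP => X g hg.
by rewrite (xy X g hg) (yz X g hg).
Qed.
Canonical coker_equiv :=
  EquivRel coker_rel coker_rel_refl coker_rel_sym coker_rel_trans.

Definition Coker : Type := {eq_quot coker_equiv}.
HB.instance Definition _ := Choice.on Coker.
HB.instance Definition _ := EqQuotient.on Coker.

Definition coker_pi (b : M) : Coker := \pi_Coker b.

Lemma coker_piP (b b' : M) :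
  coker_pi b = coker_pi b' <->
  forall (X : bmodsType) (g : {bmods M -> X}), range_in_ker g -> g b = g b'.
Proof. by split=> [/eqmodP/asboolP|H]; last by apply/eqmodP/asboolP. Qed.

Lemma coker_repr (b : M) (X : bmodsType) (g : {bmods M -> X}) :
  range_in_ker g -> g (repr (coker_pi b)) = g b.
Proof. by move: X g; apply/coker_piP; rewrite /coker_pi reprK. Qed.

Definition coker_add (x y : Coker) : Coker := coker_pi (repr x + repr y).
Definition coker_sigma (x : Coker) : Coker := coker_pi (sigma (repr x)).

Lemma coker_addE (a b : M) :
  coker_add (coker_pi a) (coker_pi b) = coker_pi (a + b).
Proof. by apply/coker_piP => X g hg; rewrite !raddfD /= !coker_repr. Qed.
Lemma coker_sigmaE (a : M) : coker_sigma (coker_pi a) = coker_pi (sigma a).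
Proof. by apply/coker_piP => X g hg; rewrite !sigma_morph coker_repr. Qed.
Lemma coker_ind (P : Coker -> Prop) :
  (forall b, P (coker_pi b)) -> forall x, P x.
Proof. by move=> H x; rewrite -(reprK x); apply: H. Qed.

Lemma coker_addA : associative coker_add.
Proof.
elim/coker_ind=> a; elim/coker_ind=> b; elim/coker_ind=> c.
by rewrite !coker_addE addrA.
Qed.
Lemma coker_addC : commutative coker_add.
Proof.
by elim/coker_ind=> a; elim/coker_ind=> b; rewrite !coker_addE addrC.
Qed.
Lemma coker_add0 : left_id (coker_pi 0) coker_add.
Proof. by elim/coker_ind=> a; rewrite coker_addE add0r. Qed.
HB.instance Definition _ :=
  GRing.isNmodule.Build Coker coker_addA coker_addC coker_add0.

Lemma coker_addbb (x : Coker) : x + x = x.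
Proof. by elim/coker_ind: x => a; rewrite [LHS]coker_addE addbb. Qed.
Lemma coker_sigma0 : coker_sigma 0 = 0.
Proof. by rewrite [LHS]coker_sigmaE sigma0. Qed.
Lemma coker_sigmaD : {morph coker_sigma : x y / x + y}.
Proof.
elim/coker_ind=> a; elim/coker_ind=> b.
by rewrite [X in coker_sigma X]coker_addE !coker_sigmaE [RHS]coker_addE sigmaD.
Qed.
Lemma coker_sigmaK : involutive coker_sigma.
Proof. by elim/coker_ind=> a; rewrite !coker_sigmaE sigmaK. Qed.
HB.instance Definition _ :=
  Nmodule_isBmods.Build Coker coker_addbb coker_sigma0 coker_sigmaD coker_sigmaK.

Lemma coker_pi_nmod : GRing.nmod_morphism coker_pi.
Proof. by split=> // x y; rewrite [RHS]coker_addE. Qed.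
Lemma coker_pi_sigma : {morph coker_pi : x / sigma x}.
Proof. by move=> x; rewrite [RHS]coker_sigmaE. Qed.
HB.instance Definition _ := GRing.isNmodMorphism.Build M Coker coker_pi coker_pi_nmod.
HB.instance Definition _ := isSigmaMorphism.Build M Coker coker_pi coker_pi_sigma.

Definition coker_proj : {bmods M -> Coker} := coker_pi.

Lemma coker_proj_range : range_in_ker coker_proj.
Proof.
move=> x; rewrite !inE; apply/eqP; rewrite [LHS]coker_sigmaE.
apply/coker_piP => X g /(_ x); rewrite !inE sigma_morph.
by move=> /eqP.
Qed.

Section Descent.
Variables (X : bmodsType) (g : {bmods M -> X}) (hg : range_in_ker g).

(* [hg] is an argument so that the morphism instances below can be inferred *)
Definition coker_desc_fun of range_in_ker g := fun x : Coker => g (repr x).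

Lemma coker_desc_funE (b : M) : coker_desc_fun hg (coker_pi b) = g b.
Proof. exact: coker_repr. Qed.

Lemma coker_desc_nmod : GRing.nmod_morphism (coker_desc_fun hg).
Proof.
split=> [|]; first by rewrite [LHS]coker_desc_funE raddf0.
elim/coker_ind=> a; elim/coker_ind=> b.
by rewrite -[X in coker_desc_fun hg X](raddfD coker_proj) !coker_desc_funE raddfD.
Qed.
Lemma coker_desc_sigma : {morph coker_desc_fun hg : x / sigma x}.
Proof.
elim/coker_ind=> a.
by rewrite -[X in coker_desc_fun hg X]coker_pi_sigma !coker_desc_funE sigma_morph.
Qed.
HB.instance Definition _ :=
  GRing.isNmodMorphism.Build Coker X (coker_desc_fun hg) coker_desc_nmod.
HB.instance Definition _ :=
  isSigmaMorphism.Build Coker X (coker_desc_fun hg) coker_desc_sigma.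

Definition coker_desc : {bmods Coker -> X} := coker_desc_fun hg.
End Descent.

End Cokernel.

Section CokerMap.
Variables (L M L' M' : bmodsType) (h : {bmods L -> M}) (h' : {bmods L' -> M'}).
Variables (a : {bmods L -> L'}) (b : {bmods M -> M'}).
Hypothesis sq : bcomp b h = bcomp h' a.

Lemma coker_map_subproof : range_in_ker h (bcomp (coker_proj h') b).
Proof.
move=> x; have hx : b (h x) = h' (a x) := congr1 (fun f : {bmods L -> M'} => f x) sq.
by have := coker_proj_range h' (a x); rewrite !inE /= hx.
Qed.

Definition coker_map : {bmods Coker h -> Coker h'} := coker_desc coker_map_subproof.

Lemma coker_mapE (y : M) : coker_map (coker_proj h y) = coker_proj h' (b y).
Proof. exact: coker_desc_funE. Qed.
End CokerMap.

Section Hom.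
Variables L M : bmodsType.
Implicit Types f g : {bmods L -> M}.

Lemma bhom_add_nmod f g : GRing.nmod_morphism (fun x => f x + g x).
Proof. by split=> [|x y]; rewrite ?raddf0 ?addr0 // !raddfD addrACA. Qed.
Lemma bhom_add_sigma f g : {morph (fun x => f x + g x) : x / sigma x}.
Proof. by move=> x; rewrite !sigma_morph sigmaD. Qed.
Lemma bhom_zero_nmod : GRing.nmod_morphism (fun _ : L => 0 : M).
Proof. by split=> [|x y]; rewrite ?addr0. Qed.
Lemma bhom_zero_sigma : {morph (fun _ : L => 0 : M) : x / sigma x}.
Proof. by move=> x; rewrite sigma0. Qed.
Lemma bhom_sigma_nmod f : GRing.nmod_morphism (fun x => sigma (f x)).
Proof. by split=> [|x y]; rewrite ?raddf0 ?sigma0 // raddfD sigmaD. Qed.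
Lemma bhom_sigma_sigma f : {morph (fun x => sigma (f x)) : x / sigma x}.
Proof. by move=> x; rewrite sigma_morph. Qed.

Definition bhom_add f g : {bmods L -> M} :=
  HB.pack (fun x => f x + g x)
    (GRing.isNmodMorphism.Build L M _ (bhom_add_nmod f g))
    (isSigmaMorphism.Build L M _ (bhom_add_sigma f g)).
Definition bhom_zero : {bmods L -> M} :=
  HB.pack (fun _ : L => 0 : M)
    (GRing.isNmodMorphism.Build L M _ bhom_zero_nmod)
    (isSigmaMorphism.Build L M _ bhom_zero_sigma).
Definition bhom_sigma f : {bmods L -> M} :=
  HB.pack (fun x => sigma (f x))
    (GRing.isNmodMorphism.Build L M _ (bhom_sigma_nmod f))
    (isSigmaMorphism.Build L M _ (bhom_sigma_sigma f)).

Lemma bhom_addA : associative bhom_add.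
Proof. by move=> f g k; apply: bmods_hom_ext => x /=; rewrite addrA. Qed.
Lemma bhom_addC : commutative bhom_add.
Proof. by move=> f g; apply: bmods_hom_ext => x /=; rewrite addrC. Qed.
Lemma bhom_add0 : left_id bhom_zero bhom_add.
Proof. by move=> f; apply: bmods_hom_ext => x /=; rewrite add0r. Qed.

HB.instance Definition _ := gen_eqMixin {bmods L -> M}.
HB.instance Definition _ := gen_choiceMixin {bmods L -> M}.
HB.instance Definition _ :=
  GRing.isNmodule.Build {bmods L -> M} bhom_addA bhom_addC bhom_add0.

Lemma bhom_addbb f : f + f = f.
Proof. by apply: bmods_hom_ext => x; rewrite [LHS]addbb. Qed.
Lemma bhom_sigma0 : bhom_sigma 0 = 0.
Proof. by apply: bmods_hom_ext => x; exact: sigma0. Qed.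
Lemma bhom_sigmaD : {morph bhom_sigma : f g / f + g}.
Proof. by move=> f g; apply: bmods_hom_ext => x; exact: sigmaD. Qed.
Lemma bhom_sigmaK : involutive bhom_sigma.
Proof. by move=> f; apply: bmods_hom_ext => x; exact: sigmaK. Qed.
HB.instance Definition _ := Nmodule_isBmods.Build {bmods L -> M}
  bhom_addbb bhom_sigma0 bhom_sigmaD bhom_sigmaK.
End Hom.

Definition Hom (L M : bmodsType) : bmodsType := {bmods L -> M}.

Section HomFunctor.
Variables (Q M N : bmodsType) (f : {bmods M -> N}).

Definition hom_post (u : Hom Q M) : Hom Q N := bcomp f u.

Lemma hom_post_nmod : GRing.nmod_morphism hom_post.
Proof.
by split=> [|u v]; apply: bmods_hom_ext => x; [exact: raddf0 | exact: raddfD].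
Qed.
Lemma hom_post_sigma : {morph hom_post : u / sigma u}.
Proof. by move=> u; apply: bmods_hom_ext => x; exact: sigma_morph. Qed.
HB.instance Definition _ :=
  GRing.isNmodMorphism.Build (Hom Q M) (Hom Q N) hom_post hom_post_nmod.
HB.instance Definition _ :=
  isSigmaMorphism.Build (Hom Q M) (Hom Q N) hom_post hom_post_sigma.

Definition hom_map : {bmods Hom Q M -> Hom Q N} := hom_post.
End HomFunctor.
Arguments hom_map Q {M N} f.

Lemma hom_map_comp (Q L M N : bmodsType) (g : {bmods M -> N}) (f : {bmods L -> M}) :
  hom_map Q (bcomp g f) = bcomp (hom_map Q g) (hom_map Q f).
Proof. by apply: bmods_hom_ext => u; apply: bmods_hom_ext. Qed.

Definition is_kernel (L M N : bmodsType) (m : {bmods L -> M}) (q : {bmods M -> N}) :=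
  exists phi : {bmods L -> Ker q}, bmods_iso phi /\ bcomp (ker_incl q) phi = m.

Definition is_cokernel (L M N : bmodsType) (m : {bmods L -> M}) (q : {bmods M -> N}) :=
  exists psi : {bmods Coker m -> N}, bmods_iso psi /\ bcomp psi (coker_proj m) = q.

Record sdexact := SDExact {
  sd_sub : bmodsType;
  sd_mid : bmodsType;
  sd_quo : bmodsType;
  sd_in : {bmods sd_sub -> sd_mid};
  sd_out : {bmods sd_mid -> sd_quo};
  sd_is_kernel : is_kernel sd_in sd_out;
  sd_is_cokernel : is_cokernel sd_in sd_out
}.

Record sdexact_hom (c d : sdexact) := SDExactHom {
  hom_sub : {bmods sd_sub c -> sd_sub d};
  hom_mid : {bmods sd_mid c -> sd_mid d};
  hom_quo : {bmods sd_quo c -> sd_quo d};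
  hom_in_comm : bcomp hom_mid (sd_in c) = bcomp (sd_in d) hom_sub;
  hom_out_comm : bcomp hom_quo (sd_out c) = bcomp (sd_out d) hom_mid
}.

Section ConditionA.
Variables (Q : bmodsType) (c d : sdexact).

Lemma hom_coker_square (w : sdexact_hom c d) :
  bcomp (hom_map Q (hom_quo w)) (hom_map Q (sd_out c)) =
  bcomp (hom_map Q (sd_out d)) (hom_map Q (hom_mid w)).
Proof. by rewrite -!hom_map_comp hom_out_comm. Qed.

(* F(w'') : Coker(F(c'')) -> Coker(F(d'')), for F = Hom(Q, -) *)
Definition hom_coker (w : sdexact_hom c d) :
    {bmods Coker (hom_map Q (sd_out c)) -> Coker (hom_map Q (sd_out d))} :=
  coker_map (hom_coker_square w).

Definition condition_a (v : {bmods sd_sub c -> sd_sub d}) : Prop :=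
  forall w1 w2 : sdexact_hom c d,
    hom_sub w1 = v -> hom_sub w2 = v -> hom_coker w1 = hom_coker w2.
End ConditionA.
Arguments condition_a Q c d v : clear implicits.

(* Main.v *)
Require Import Defs.
From HB Require Import structures.
From mathcomp Require Import all_boot ssralg.

Set Implicit Arguments.
Unset Strict Implicit.
Unset Printing Implicit Defensive.

(** Coker(F(c'')) consists of the classes of the morphisms f : I'' -> C''.
    Since I is projective, f o i'' lifts along c'' to a morphism I -> C, which
    restricts to the kernels; so f extends to a morphism iota -> c of short
    doubly exact sequences. Composing it with w1 and w2 gives two endomorphisms
    of iota inducing the same endomorphism of I', and by hypothesis their
    actions on the class of the identity of I'' agree: these are the images of
    the class of f under F(w1'') and F(w2''). *)

Lemma bcompA (K L M N : bmodsType) (h : {bmods M -> N}) (g : {bmods L -> M})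
    (f : {bmods K -> L}) : bcomp h (bcomp g f) = bcomp (bcomp h g) f.
Proof. exact: bmods_hom_ext. Qed.

Section KernelLift.
Variables (K M N : bmodsType) (q : {bmods M -> N}) (g : {bmods K -> M}).
Hypothesis gP : forall x, ker_pred q (g x).

Definition ker_lift_fun (x : K) : Ker q := InKer (gP x).

Lemma ker_lift_nmod : GRing.nmod_morphism ker_lift_fun.
Proof.
split=> [|x y]; apply: val_inj.
  by rewrite [RHS](ker_val_nmod q).1; exact: GRing.raddf0.
by rewrite [RHS](ker_val_nmod q).2; exact: GRing.raddfD.
Qed.

Lemma ker_lift_sigma : {morph ker_lift_fun : x / sigma x}.
Proof. by move=> x; apply: val_inj; exact: sigma_morph. Qed.

HB.instance Definition _ :=
  GRing.isNmodMorphism.Build K (Ker q) ker_lift_fun ker_lift_nmod.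
HB.instance Definition _ :=
  isSigmaMorphism.Build K (Ker q) ker_lift_fun ker_lift_sigma.

Definition ker_lift : {bmods K -> Ker q} := ker_lift_fun.
End KernelLift.

Lemma is_kernel_range (L M N : bmodsType) (m : {bmods L -> M})
    (q : {bmods M -> N}) (x : L) : is_kernel m q -> ker_pred q (m x).
Proof. by case=> phi [_ <-]; exact: ker_valP. Qed.

(** Universal property of the kernel: [g] corestricts to [Ker q] by [ker_lift], and the inverse
    [psi] of the isomorphism [phi] carries the result to [L]. *)
Lemma is_kernel_lift (K L M N : bmodsType) (m : {bmods L -> M})
    (q : {bmods M -> N}) (g : {bmods K -> M}) :
  is_kernel m q -> (forall x, ker_pred q (g x)) ->
  exists g' : {bmods K -> L}, bcomp m g' = g.
Proof.
case=> phi [[psi [_ phiK]] <-] gP; exists (bcomp psi (ker_lift gP)).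
apply: bmods_hom_ext => x.
exact: (congr1 (fun f : {bmods _ -> _} => ker_val (f (ker_lift gP x))) phiK).
Qed.

(** Such a [q] is surjective: through the isomorphism [psi], each element of [N] comes from a class
    in [Coker m], which has a representative in [M]. *)
Lemma is_cokernel_epi (L M N : bmodsType) (m : {bmods L -> M})
    (q : {bmods M -> N}) : is_cokernel m q -> bmods_epi q.
Proof.
case=> psi [[phi [_ psiK]] <-] X g h gh; apply: bmods_hom_ext => y.
have <- : psi (phi y) = y := congr1 (fun f : {bmods N -> N} => f y) psiK.
elim/coker_ind: (phi y) => x.
exact: (congr1 (fun f : {bmods M -> X} => f x) gh).
Qed.

Lemma sdexact_hom_extend (c d : sdexact) (f : {bmods sd_quo c -> sd_quo d}) :
  projective_object (sd_mid c) -> exists w : sdexact_hom c d, hom_quo w = f.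
Proof.
move=> projc.
have out_epi := is_cokernel_epi (sd_is_cokernel d).
have [g gE] := projc _ _ _ (bcomp f (sd_out c)) out_epi.
(* Morphisms preserve fixed points of [sigma]: [sd_out c (sd_in c x)] is fixed, hence so is its
   image under [f]. *)
have gP x : ker_pred (sd_out d) (bcomp g (sd_in c) x).
  have gx : sd_out d (g (sd_in c x)) = f (sd_out c (sd_in c x)).
    exact: (congr1 (fun k : {bmods _ -> _} => k (sd_in c x)) gE).
  have /eqP qx := is_kernel_range x (sd_is_kernel c).
  by apply/eqP; rewrite [sd_out d _]gx -sigma_morph qx.
have [g' g'E] := is_kernel_lift (sd_is_kernel d) gP.
by exists (SDExactHom (esym g'E) (esym gE)).
Qed.

Section Composition.
Variables (c d e : sdexact) (w : sdexact_hom d e) (u : sdexact_hom c d).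

Lemma sdexact_comp_in :
  bcomp (bcomp (hom_mid w) (hom_mid u)) (sd_in c) =
  bcomp (sd_in e) (bcomp (hom_sub w) (hom_sub u)).
Proof. by rewrite -bcompA hom_in_comm !bcompA hom_in_comm. Qed.

Lemma sdexact_comp_out :
  bcomp (bcomp (hom_quo w) (hom_quo u)) (sd_out c) =
  bcomp (sd_out e) (bcomp (hom_mid w) (hom_mid u)).
Proof. by rewrite -bcompA hom_out_comm !bcompA hom_out_comm. Qed.

Definition sdexact_comp : sdexact_hom c e :=
  SDExactHom sdexact_comp_in sdexact_comp_out.
End Composition.

(** A Yoneda-style evaluation at the identity: both sides are the class of
    [bcomp (hom_quo w) (hom_quo u)]. *)
Lemma hom_coker_comp_id (c d : sdexact) (w : sdexact_hom c d) (iota : sdexact)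
    (u : sdexact_hom iota c) :
  hom_coker (sd_quo iota) (sdexact_comp w u)
    (coker_proj (hom_map (sd_quo iota) (sd_out iota)) (bid (sd_quo iota))) =
  hom_coker (sd_quo iota) w
    (coker_proj (hom_map (sd_quo iota) (sd_out c)) (hom_quo u)).
Proof.
by rewrite /hom_coker !coker_mapE; congr (coker_proj _ _); exact: bmods_hom_ext.
Qed.

Theorem theorem1p11 (iota : sdexact)
  (I_injective : injective_object (sd_mid iota))
  (I_projective : projective_object (sd_mid iota))
  (end_condition_a :
     forall v : {bmods sd_sub iota -> sd_sub iota},
       condition_a (sd_quo iota) iota iota v) :
  forall (c : sdexact) (v : {bmods sd_sub c -> sd_sub iota}),
    condition_a (sd_quo iota) c iota v.
Proof.
move=> c v w1 w2 w1v w2v; apply: bmods_hom_ext; elim/coker_ind => f.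
have [u <-] := sdexact_hom_extend f I_projective.
rewrite -[LHS]hom_coker_comp_id -[RHS]hom_coker_comp_id.
(* Whatever [hom_sub u] is, both composites with [u] induce the same endomorphism
   [bcomp v (hom_sub u)], since [w1] and [w2] both induce [v]. *)
rewrite (end_condition_a (bcomp v (hom_sub u)) _ (sdexact_comp w2 u)) //=.
  by rewrite w1v.
by rewrite w2v.
Qed.
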